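(* For every (nonempty) bounded domain $\Omega\subset\mathbb H$ there exists a $\psi$-regular function $f:\Omega\to\mathbb H$ that is not $J_p$-holomorphic on $\Omega$ for any $p\in\mathbb S^2$; that is, the inclusion \[\bigcup_{p\in\mathbb S^2}Hol_p(\Omega,\mathbb H)\subset\mathcal R(\Omega)\] is proper.
   Context: Identify $\mathbb H\simeq\mathbb R^4$ via $q=x_0+ix_1+jx_2+kx_3$. $\mathbb S^2=\{p\in\mathbb H: p^2=-1\}$ is the sphere of unit imaginary quaternions $p=p_1i+p_2j+p_3k$. A function $f\in C^1(\Omega,\mathbb H)$ is (left) $\psi$-regular on $\Omega$ if \[\frac{\partial f}{\partial x_0}+i\frac{\partial f}{\partial x_1}+j\frac{\partial f}{\partial x_2}-k\frac{\partial f}{\partial x_3}=0\quad\text{on }\Omega;\] $\mathcal R(\Omega)$ denotes the set of $\psi$-regular functions on $\Omega$. On each tangent space $T_x\mathbb H\simeq\mathbb H$, $J_1$ and $J_2$ are left multiplication by $i$ and $j$, and $J_3=-J_1J_2$ (so $J_3$ is left multiplication by $-k$). For $p\in\mathbb S^2$ put $J_p=p_1J_1+p_2J_2+p_3J_3$, and let $L_p$ be left multiplication by $p$ on the target $\mathbb H$. $Hol_p(\Omega,\mathbb H)$ is the set of ($C^1$) maps $f:\Omega\to\mathbb H$ that are holomorphic from $(\Omega,J_p)$ to $(\mathbb H,L_p)$, i.e. such that $df+L_p\circ df\circ J_p=0$ on $\Omega$; such maps are called $J_p$-holomorphic on $\Omega$. *)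

(* Defs.v *)
From HB Require Import structures.
From mathcomp Require Import all_boot all_order all_algebra.
From mathcomp Require Import all_classical all_reals all_analysis.

Set Implicit Arguments.
Unset Strict Implicit.
Unset Printing Implicit Defensive.

Import Order.TTheory GRing.Theory Num.Theory.
Import numFieldNormedType.Exports.

Local Open Scope classical_set_scope.
Local Open Scope ring_scope.

(* A quaternion x0 + i x1 + j x2 + k x3 is the row vector (x0, x1, x2, x3).
   The norm on 'rV[R]_4 is the sup norm; it is equivalent to the Euclidean one,
   so open sets, bounded sets and derivatives are the usual ones. *)
Notation quat R := 'rV[R]_4.

Section Quaternions.
Context {R : realType}.
Implicit Types a b p v : quat R.

Definition qmk (x0 x1 x2 x3 : R) : quat R :=
  \row_(m < 4) nth 0 [:: x0; x1; x2; x3] m.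

Definition qone : quat R := qmk 1 0 0 0.
Definition qi : quat R := qmk 0 1 0 0.
Definition qj : quat R := qmk 0 0 1 0.
Definition qk : quat R := qmk 0 0 0 1.

(* Hamilton product; numerals in index position are elements of 'I_4. *)
Definition qmul a b : quat R := qmk
  (a 0 0 * b 0 0 - a 0 1 * b 0 1 - a 0 2 * b 0 2 - a 0 3 * b 0 3)
  (a 0 0 * b 0 1 + a 0 1 * b 0 0 + a 0 2 * b 0 3 - a 0 3 * b 0 2)
  (a 0 0 * b 0 2 - a 0 1 * b 0 3 + a 0 2 * b 0 0 + a 0 3 * b 0 1)
  (a 0 0 * b 0 3 + a 0 1 * b 0 2 - a 0 2 * b 0 1 + a 0 3 * b 0 0).

Definition imag_sphere : set (quat R) := [set p | qmul p p = - qone].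

Definition J1 v : quat R := qmul qi v.
Definition J2 v : quat R := qmul qj v.
Definition J3 v : quat R := - J1 (J2 v).

Definition Jstr p v : quat R := p 0 1 *: J1 v + p 0 2 *: J2 v + p 0 3 *: J3 v.

Definition domain (Omega : set (quat R)) : Prop :=
  [/\ open Omega, connected Omega & Omega !=set0].

(* Functions on Omega are represented by total functions; as Omega is open, the
   conditions below only depend on the values on Omega. *)
Definition C1_on (Omega : set (quat R)) (f : quat R -> quat R) : Prop :=
  forall x, Omega x -> differentiable f x /\
    forall v, {for x, continuous (fun y => 'd f y v)}.

Definition psi_regular (Omega : set (quat R)) : set (quat R -> quat R) :=
  [set f | C1_on Omega f /\
    forall x, Omega x ->
      'D_qone f x + qmul qi ('D_qi f x) + qmul qj ('D_qj f x)
        - qmul qk ('D_qk f x) = 0].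

Definition Hol p (Omega : set (quat R)) : set (quat R -> quat R) :=
  [set f | C1_on Omega f /\
    forall x, Omega x ->
      forall v, 'd f x v + qmul p ('d f x (Jstr p v)) = 0].

End Quaternions.

(* Main.v *)
(* With [p' = p1 i + p2 j - p3 k], [f] is [J_p]-holomorphic iff each differential
   [L] of [f] satisfies [L (p' v) = p (L v)], that is, iff [L] is complex linear
   for the structures given by [p'] and [p]; summing [L v + p (L (p' v)) = 0] over
   [v = 1, i, j, k] with left coefficients [1, i, j, -k] yields twice the
   psi-regularity equation. The real rank of such an [L] is even,
   so a psi-regular linear map of rank 3 is not [J_p]-holomorphic for any [p]. *)
Require Import Defs.
From HB Require Import structures.
From mathcomp Require Import all_boot all_order all_algebra.
From mathcomp Require Import all_classical all_reals all_analysis.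
From mathcomp Require Import ring lra.

Import Order.TTheory GRing.Theory Num.Theory.
Import numFieldNormedType.Exports.

Local Open Scope classical_set_scope.
Local Open Scope ring_scope.

Lemma qmkE {R : realType} (a b c d : R) :
  (qmk a b c d 0 0 = a) * (qmk a b c d 0 1 = b)
  * (qmk a b c d 0 2 = c) * (qmk a b c d 0 3 = d).
Proof. by do !split; rewrite mxE. Qed.

Lemma quatE {R : realType} (v : quat R) :
  v = qmk (v 0 0) (v 0 1) (v 0 2) (v 0 3).
Proof.
by apply/rowP => -[[|[|[|[|//]]]] lt_m4]; rewrite mxE;
  congr (v _ _); apply: val_inj.
Qed.

Lemma qmk_inj {R : realType} (a b c d a' b' c' d' : R) :
  qmk a b c d = qmk a' b' c' d' -> [/\ a = a', b = b', c = c' & d = d'].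
Proof.
by move=> /rowP e; have := (e 0, e 1, e 2, e 3); rewrite !qmkE => -[[[]]].
Qed.

Lemma qmk0 {R : realType} : (0 : quat R) = qmk 0 0 0 0.
Proof. by rewrite [LHS]quatE !mxE. Qed.

Lemma qmkD {R : realType} (a b c d a' b' c' d' : R) :
  qmk a b c d + qmk a' b' c' d' = qmk (a + a') (b + b') (c + c') (d + d').
Proof. by rewrite [LHS]quatE !(mxE, qmkE). Qed.

Lemma qmkN {R : realType} (a b c d : R) :
  - qmk a b c d = qmk (- a) (- b) (- c) (- d).
Proof. by rewrite [LHS]quatE !(mxE, qmkE). Qed.

Lemma qmkZ {R : realType} (t a b c d : R) :
  t *: qmk a b c d = qmk (t * a) (t * b) (t * c) (t * d).
Proof. by rewrite [LHS]quatE !(mxE, qmkE). Qed.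

Lemma qmul_qmk {R : realType} (a b c d a' b' c' d' : R) :
  qmul (qmk a b c d) (qmk a' b' c' d') =
  qmk (a * a' - b * b' - c * c' - d * d') (a * b' + b * a' + c * d' - d * c')
      (a * c' - b * d' + c * a' + d * b') (a * d' + b * c' - c * b' + d * a').
Proof. by rewrite /qmul !qmkE. Qed.

Lemma qmul_units {R : realType} (a b c d : R) :
  (qmul qi (qmk a b c d) = qmk (- b) a (- d) c)
  * (qmul qj (qmk a b c d) = qmk (- c) d a (- b))
  * (qmul qk (qmk a b c d) = qmk (- d) (- c) b a).
Proof. by do !split; rewrite /qi /qj /qk qmul_qmk; congr qmk; ring. Qed.

Definition qarithE (R : realType) :=
  (@qmul_units R, @qmul_qmk R, @qmkD R, @qmkN R, @qmkZ R).

Lemma imag_sphere_coord {R : realType} (p : quat R) : imag_sphere p ->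
  p 0 0 = 0 /\ p 0 1 ^+ 2 + p 0 2 ^+ 2 + p 0 3 ^+ 2 = 1.
Proof.
rewrite /imag_sphere /= /qone qmkN [p]quatE qmul_qmk !qmkE => /qmk_inj[h0 h1 h2 h3].
(* If [p 0 0] were nonzero, [h1], [h2], [h3] would kill the imaginary part and [h0] would make its
   square -1. *)
have p00 : p 0 0 = 0 by nra.
by split=> //; move: h0; rewrite p00; lra.
Qed.

(** [Jstr p] is left multiplication by p1 i + p2 j - p3 k; values written as combinations of the
    units let a linear map pass through. *)
Lemma Jstr_basis {R : realType} (p : quat R) :
  (Jstr p qone = p 0 1 *: qi + p 0 2 *: qj + - p 0 3 *: qk)
  * (Jstr p qi = - p 0 1 *: qone + - p 0 3 *: qj + - p 0 2 *: qk)
  * (Jstr p qj = - p 0 2 *: qone + p 0 3 *: qi + p 0 1 *: qk)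
  * (Jstr p qk = p 0 3 *: qone + p 0 2 *: qi + - p 0 1 *: qj).
Proof.
by do !split; rewrite /Jstr /J3 /J1 /J2 /qone /qi /qj /qk !qarithE;
  congr qmk; ring.
Qed.

(* The four brackets are [L v + p (L (p' v))], [p' = p1 i + p2 j - p3 k], for
   [v = 1, i, j, k], where [L] sends these to [A], [B], [C], [D]. *)
Lemma Hol_combination {R : realType} {p : quat R} (A B C D : quat R) : p 0 0 = 0 ->
  (A + qmul p (p 0 1 *: B + p 0 2 *: C + - p 0 3 *: D))
  + qmul qi (B + qmul p (- p 0 1 *: A + - p 0 3 *: C + - p 0 2 *: D))
  + qmul qj (C + qmul p (- p 0 2 *: A + p 0 3 *: B + p 0 1 *: D))
  - qmul qk (D + qmul p (p 0 3 *: A + p 0 2 *: B + - p 0 1 *: C))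
  = (1 + (p 0 1 ^+ 2 + p 0 2 ^+ 2 + p 0 3 ^+ 2))
    *: (A + qmul qi B + qmul qj C - qmul qk D).
Proof.
(* [qmul] is abstracted as it unfolds to a [qmk], which [qmkD] would then match. *)
move: (@qmul R) (@qmul_qmk R) (@qmul_units R) => mul mulE unitsE p0.
rewrite [A]quatE [B]quatE [C]quatE [D]quatE [p]quatE !qmkE p0.
rewrite !(qmkZ, qmkN, qmkD, unitsE, mulE).
by congr qmk; ring.
Qed.

Lemma linear_Hol_regular {R : realType} {p : quat R}
    (L : {linear quat R -> quat R}) :
  imag_sphere p -> (forall v, L v + qmul p (L (Jstr p v)) = 0) ->
  L qone + qmul qi (L qi) + qmul qj (L qj) - qmul qk (L qk) = 0.
Proof.
move=> /imag_sphere_coord[p0 p1] H.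
have q0 (q : quat R) : qmul q 0 = 0.
  by rewrite [q]quatE qmk0 qmul_qmk; congr qmk; ring.
move: (H qk) (H qj) (H qi) (H qone).
rewrite !Jstr_basis !linearD !linearZ /= => h3 h2 h1 h0.
have := Hol_combination (L qone) (L qi) (L qj) (L qk) p0.
rewrite h0 h1 h2 h3 !q0 subr0 !addr0.
(* On the sphere the scalar factor is 1 + 1, which cancels. *)
rewrite p1 => /esym S0; apply/eqP; move/eqP: S0.
by rewrite scaler_eq0 -mulr2n pnatr_eq0.
Qed.

(** In the standard basis [L] is a finite sum of continuous coordinates times fixed vectors. *)
Lemma linear_rV_continuous {R : realType} n (V : normedModType R)
  (L : {linear 'rV[R]_n -> V}) : continuous L.
Proof.
have -> : (L : _ -> _) = (fun v : 'rV[R]_n => \sum_i v 0 i *: L (delta_mx 0 i)).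
  apply/funext => v; rewrite {1}(row_sum_delta v) linear_sum.
  by apply: eq_bigr => i _; rewrite linearZ.
apply: continuous_big => [|i _ w]; first exact: add_continuous.
apply: (@continuous_comp _ _ _ (fun v : 'rV[R]_n => v 0 i) ( *:%R ^~ _)).
- exact: coord_continuous.
- exact: scalel_continuous.
Qed.

Lemma linear_C1_on {R : realType} (Omega : set (quat R))
  (L : {linear quat R -> quat R}) : C1_on Omega L.
Proof.
have Lc := @linear_rV_continuous R 4 _ L.
move=> x _; split; first exact: linear_differentiable.
(* A linear map is its own differential at every point. *)
move=> v; rewrite (_ : (fun y => _) = (fun=> L v)); first exact: cst_continuous.
by apply/funext => y; rewrite diff_lin.
Qed.

Lemma Hol_psi_regular {R : realType} (Omega : set (quat R)) (p : quat R) :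
  imag_sphere p -> Hol p Omega `<=` psi_regular Omega.
Proof.
move=> Sp f [f1 fp]; split=> // x Ox; have [df _] := f1 x Ox.
by rewrite !deriveE //; apply: (linear_Hol_regular ('d f x) Sp); apply: fp.
Qed.

(** A diagonal map with entries a, b, c, d is psi-regular iff a - b - c + d = 0; the entries 2, 1,
    1, 0 satisfy this with exactly one zero, so the rank is odd. *)
Definition rank3 {R : realType} : quat R -> quat R :=
  mulmxr (diag_mx (qmk 2 1 1 0)).

HB.instance Definition _ (R : realType) := GRing.Linear.on (@rank3 R).

Lemma rank3E {R : realType} (v : quat R) :
  rank3 v = qmk (2 * v 0 0) (v 0 1) (v 0 2) 0.
Proof.
by rewrite [LHS]quatE /rank3 /= mul_mx_diag !mxE /= mulr0 !mulr1 mulrC.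
Qed.

Lemma rank3_psi_regular {R : realType} (Omega : set (quat R)) :
  psi_regular Omega (@rank3 R).
Proof.
have L1 := linear_C1_on Omega rank3.
split=> // x Ox; rewrite !deriveE; do ?by case: (L1 x Ox).
rewrite diff_lin; last exact: linear_rV_continuous.
rewrite /= !rank3E.
rewrite /qone /qi /qj /qk !qmkE !qarithE qmk0.
by congr qmk; ring.
Qed.

(** Parity of the rank is replaced by a test at [qk]: it lies in the kernel of [rank3], so only
    [qmul p (rank3 (Jstr p qk)) = 0] remains. *)
Lemma rank3_not_Hol {R : realType} (Omega : set (quat R)) (p : quat R) :
  Omega !=set0 -> imag_sphere p -> ~ Hol p Omega (@rank3 R).
Proof.
move=> [x Ox] /imag_sphere_coord[p0 p1] [_ /(_ x Ox qk)].
rewrite diff_lin; last exact: linear_rV_continuous.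
rewrite /= Jstr_basis /qone /qi /qj /qk !qarithE !rank3E !qmkE.
rewrite [p]quatE !qmkE p0 !qarithE qmk0 => /qmk_inj[h0 h1 h2 h3].
(* [h1] and [h2] say that [p 0 3] times [p 0 1] and times [p 0 2] vanish, [h3] that
   [2 * p 0 3 ^+ 2 = p 0 1 ^+ 2 + p 0 2 ^+ 2]; multiplying the latter by [p 0 3] gives
   [p 0 3 ^+ 3 = 0]. *)
have p3 : p 0 3 = 0 by nra.
have p2 : p 0 2 = 0 by nra.
have p11 : p 0 1 = 0 by nra.
by move: p1; rewrite p3 p2 p11; lra.
Qed.

Theorem mainTheorem2 (R : realType) (Omega : set (quat R))
    (domainOmega : domain Omega) (boundedOmega : bounded_set Omega) :
  (exists f : quat R -> quat R,
     psi_regular Omega f /\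
     forall p : quat R, imag_sphere p -> ~ Hol p Omega f) /\
  \bigcup_(p in imag_sphere) Hol p Omega `<` psi_regular Omega.
Proof.
have [_ _ Omega0] := domainOmega.
split; last split.
- exists (@rank3 R); split; first exact: rank3_psi_regular.
  by move=> p; apply: rank3_not_Hol.
- by move=> f [p Sp]; apply: Hol_psi_regular.
- move=> /(_ _ (rank3_psi_regular Omega))[p Sp]; exact: rank3_not_Hol.
Qed.
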